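(* Let $k\ge1$, let $\mathcal{A}_k$ be the set of all $k$-atoms, and let $\mathcal{B}_k$ be the set of those $k$-atoms that are not $Tr_k^{(v,e)}$-critical or do not have transitivity equal to $k$. A graph $G$ is $Tr_k^{(v,e)}$-critical if and only if $G\in\mathcal{A}_k'=\mathcal{A}_k\setminus\mathcal{B}_k$.
   Context: All graphs are finite and simple. For disjoint $A,B\subseteq V$, $A$ dominates $B$ if every vertex of $B$ is adjacent to at least one vertex of $A$. A transitive $k$-partition of $G=(V,E)$ is a partition $\{V_1,\dots,V_k\}$ of $V$ into $k$ nonempty parts such that $V_i$ dominates $V_j$ for all $1\le i<j\le k$; the transitivity $Tr(G)$ is the maximum such $k$. A graph $G=(V,E)$ is transitively vertex-edge critical if deleting any element of $V\cup E$ (deleting a vertex removes it with its incident edges) yields a graph of transitivity less than $Tr(G)$; such a graph with $Tr(G)=k$ is $Tr_k^{(v,e)}$-critical. $t$-atoms are defined recursively: the only $1$-atom is $K_1$; if $H=(V,E)$ is a $(t-1)$-atom with $n$ vertices, choose $r\in\{1,\dots,n\}$, a set $I_r$ of $r$ new independent vertices and an $r$-subset $W\subseteq V$, add a perfect matching between $I_r$ and $W$, and join each vertex of $V\setminus W$ by an edge to exactly one (arbitrary) vertex of $I_r$; every graph so obtained is a $t$-atom. Membership in $\mathcal{A}_k$ is up to isomorphism. *)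

(* Defs.v *)
From mathcomp Require Import all_boot.

Set Implicit Arguments.
Unset Strict Implicit.
Unset Printing Implicit Defensive.

Record sgraph := SGraph {
  vertex :> finType;
  edge : rel vertex;
  edge_sym : symmetric edge;
  edge_irrefl : irreflexive edge }.

Definition isomorphic (G H : sgraph) : Prop :=
  exists f : G -> H, bijective f /\ forall x y, edge (f x) (f y) = edge x y.

Section Deletion.
Variable G : sgraph.

Definition del_vertex_edge (v : G) : rel {x : G | x != v} :=
  fun x y => edge (val x) (val y).

Fact del_vertex_sym v : symmetric (@del_vertex_edge v).
Proof. by move=> x y; apply: edge_sym. Qed.

Fact del_vertex_irrefl v : irreflexive (@del_vertex_edge v).
Proof. by move=> x; apply: edge_irrefl. Qed.

Definition del_vertex (v : G) : sgraph :=
  SGraph (@del_vertex_sym v) (@del_vertex_irrefl v).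

Definition del_edge_edge (u v : G) : rel G :=
  fun x y => edge x y && ([set x; y] != [set u; v]).

Fact del_edge_sym u v : symmetric (del_edge_edge u v).
Proof. by move=> x y; rewrite /del_edge_edge edge_sym setUC. Qed.

Fact del_edge_irrefl u v : irreflexive (del_edge_edge u v).
Proof. by move=> x; rewrite /del_edge_edge edge_irrefl. Qed.

Definition del_edge (u v : G) : sgraph :=
  SGraph (@del_edge_sym u v) (@del_edge_irrefl u v).

End Deletion.

Section Transitivity.
Variable G : sgraph.

Definition dominates (A B : {set G}) : bool :=
  [forall y in B, exists x in A, edge x y].

(* The parts are listed in order, V_1 first.  [partition] excludes empty parts
   and, together with [uniq], makes the listed parts pairwise disjoint. *)
Definition transitive_partition (P : seq {set G}) : bool :=
  [&& uniq P, partition [set A in P] [set: G] & pairwise dominates P].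

(* A partition of the vertex set has at most #|G| nonempty parts, so the bound
   on k excludes nothing.  The graph without vertices has transitivity 0. *)
Definition transitivity : nat :=
  \max_(k < #|G|.+1 | [exists P : k.-tuple {set G}, transitive_partition P]) k.

End Transitivity.

Definition ve_critical (G : sgraph) : Prop :=
  (forall v : G, transitivity (del_vertex v) < transitivity G) /\
  (forall u v : G, edge u v -> transitivity (del_edge u v) < transitivity G).

Definition Tr_ve_critical (k : nat) (G : sgraph) : Prop :=
  ve_critical G /\ transitivity G = k.

Definition K1_edge : rel unit := fun _ _ => false.

Fact K1_sym : symmetric K1_edge. Proof. by []. Qed.

Fact K1_irrefl : irreflexive K1_edge. Proof. by []. Qed.

Definition K1 : sgraph := SGraph K1_sym K1_irrefl.

Section AtomExtension.
Variables (H : sgraph) (r : nat) (W : {set H}) (m : 'I_r -> H) (c : H -> 'I_r).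

(* The new vertices are the [inr i].  The new vertex i is matched with m i, an
   element of W; a vertex x outside W is joined to the single new vertex c x.
   The values of c on W are not used. *)
Definition atom_join (x : H) (i : 'I_r) : bool :=
  if x \in W then m i == x else c x == i.

Definition atom_ext_edge : rel (H + 'I_r)%type := fun a b =>
  match a, b with
  | inl x, inl y => edge x y
  | inl x, inr i => atom_join x i
  | inr i, inl x => atom_join x i
  | inr _, inr _ => false
  end.

Fact atom_ext_sym : symmetric atom_ext_edge.
Proof. by move=> [x|i] [y|j] //=; apply: edge_sym. Qed.

Fact atom_ext_irrefl : irreflexive atom_ext_edge.
Proof. by move=> [x|i] //=; apply: edge_irrefl. Qed.

Definition atom_ext : sgraph := SGraph atom_ext_sym atom_ext_irrefl.

End AtomExtension.

Inductive atom_construction : nat -> sgraph -> Prop :=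
| Atom1 : atom_construction 1 K1
| AtomS (t : nat) (H : sgraph) (r : nat) (W : {set H})
    (m : 'I_r -> H) (c : H -> 'I_r) :
    atom_construction t H ->
    1 <= r <= #|H| ->
    #|W| = r ->
    injective m ->
    [set m i | i : 'I_r] = W ->
    atom_construction t.+1 (atom_ext W m c).

Definition atoms (k : nat) (G : sgraph) : Prop :=
  exists2 H : sgraph, atom_construction k H & isomorphic G H.

Definition bad_atoms (k : nat) (G : sgraph) : Prop :=
  atoms k G /\ (~ Tr_ve_critical k G \/ transitivity G <> k).

Definition good_atoms (k : nat) (G : sgraph) : Prop :=
  atoms k G /\ ~ bad_atoms k G.

(* Main.v *)
Require Import Defs.
From mathcomp Require Import all_boot.

(** A transitive [k]-partition is encoded by its level function [f], with [V_1]
    at level 0.  Criticality forces every edge and every vertex to be needed by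
    the domination: levels are independent, every vertex has exactly one
    neighbour in each lower level, and every vertex either is alone in its level
    or dominates a vertex of a higher level.  These local conditions survive the
    removal of level 0, and adding level 0 back is an atom extension: choosing
    for each of its vertices one upper neighbour gives the matching, while
    uniqueness of lower neighbours gives the single edge to it of every other
    vertex.  So the graph is an atom by induction on [k], and no criticality of
    the smaller graph is needed. *)

Set Implicit Arguments.
Unset Strict Implicit.
Unset Printing Implicit Defensive.

Lemma isomorphic_sym (G H : sgraph) : isomorphic G H -> isomorphic H G.
Proof.
case=> f [[g fK gK] fE]; exists g; split; first by exists f.
by move=> x y; rewrite -fE !gK.
Qed.

Section Induced.
Variables (G : sgraph) (P : pred G).

Definition induced_edge : rel {x : G | P x} := fun x y => edge (val x) (val y).

Fact induced_sym : symmetric induced_edge.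
Proof. by move=> x y; apply: edge_sym. Qed.

Fact induced_irrefl : irreflexive induced_edge.
Proof. by move=> x; apply: edge_irrefl. Qed.

Definition induced : sgraph := SGraph induced_sym induced_irrefl.

End Induced.

Definition level_function (k : nat) (G : sgraph) (f : G -> nat) : Prop :=
  [/\ forall x, f x < k,
      forall i, i < k -> exists x, f x = i
    & forall x i, i < f x -> exists2 y, edge y x & f y = i].

Definition tight_levels (G : sgraph) (f : G -> nat) : Prop :=
  [/\ forall x y, edge x y -> f x != f y,
      forall x y z, edge x z -> edge y z -> f x < f z -> f y = f x -> y = x
    & forall x, (exists2 y, edge x y & f x < f y) \/
                (forall y, f y = f x -> y = x)].

Lemma transitivity_ge k (G : sgraph) (f : G -> nat) :
  level_function k f -> k <= transitivity G.
Proof.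
case=> f_lt f_onto f_dom.
(* The maximum defining the transitivity ranges over at most the number of vertices; choosing one
   vertex in each level gives [k] distinct vertices. *)
have k_le : k < #|G|.+1.
  have /fin_all_exists [g gP] : forall i : 'I_k, exists x, f x = i.
    by move=> i; apply: f_onto.
  have /leq_card : injective g by move=> i j /(congr1 f); rewrite !gP; apply: val_inj.
  by rewrite card_ord.
pose L i := [set x | f x == i].
have L_inj i j : i < k -> L i = L j -> i = j.
  case/f_onto=> x fx /setP/(_ x); rewrite !inE fx eqxx.
  by move/esym/eqP.
rewrite /transitivity.
apply: (leq_bigmax_cond (F := fun i : 'I_#|G|.+1 => nat_of_ord i) (Ordinal k_le)).
have sz : size [seq L i | i <- iota 0 k] == k by rewrite size_map size_iota.
apply/existsP; exists (Tuple sz); rewrite /transitive_partition /=.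
have in_k i : i \in iota 0 k -> i < k by rewrite mem_iota.
apply/and3P; split.
- rewrite map_inj_in_uniq ?iota_uniq // => i j /in_k i_k _; exact: L_inj.
- apply/and3P; split.
  + apply/eqP/setP=> x; rewrite inE; apply/bigcupP; exists (L (f x)); rewrite inE ?eqxx //.
    by apply/mapP; exists (f x); rewrite // mem_iota f_lt.
  + apply/trivIsetP=> A B; rewrite !inE => /mapP[i _ ->] /mapP[j _ ->].
    apply: contraR => /pred0Pn[x]; rewrite /= !inE => /andP[/eqP<- /eqP<-] //.
  + rewrite inE; apply/negP=> /mapP[i /in_k/f_onto[x fx]] /setP/(_ x).
    by rewrite !inE fx eqxx.
- rewrite pairwise_map.
  have : pairwise ltn (iota 0 k).
    by rewrite -(sorted_pairwise ltn_trans) iota_ltn_sorted.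
  apply: sub_pairwise => i j ij; apply/forall_inP=> x; rewrite inE => /eqP fx.
  have [|y yx fy] := f_dom x i; first by rewrite fx.
  by apply/exists_inP; exists y; rewrite ?inE ?fy.
Qed.

Lemma transitive_partition_level_function k (G : sgraph) (P : k.-tuple {set G}) :
  transitive_partition P -> exists f : G -> nat, level_function k f.
Proof.
case/and3P=> P_uniq /and3P[/eqP P_cover /trivIsetP P_triv P_n0] P_dom.
(* Disjointness makes this first index the only one. The value [k] that [find] returns on failure is
   excluded by [has_f], since the parts cover the graph. *)
pose f x := find (fun A : {set G} => x \in A) P.
have has_f x : has (fun A : {set G} => x \in A) P.
  have : x \in cover [set A in P] by rewrite P_cover inE.
  by case/bigcupP=> A; rewrite inE => AP xA; apply/hasP; exists A.
have f_lt x : f x < k by have := has_f x; rewrite has_find size_tuple.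
have in_f x : x \in nth set0 P (f x) by apply: (nth_find set0 (has_f x)).
have fE x i : i < k -> x \in nth set0 P i -> f x = i.
  move=> i_k xi; have sP := size_tuple P.
  apply/eqP; rewrite -(nth_uniq set0 _ _ P_uniq) ?sP //; apply/idPn.
  move/P_triv; rewrite !inE !mem_nth ?sP // => /(_ isT isT)/pred0Pn[].
  by exists x; rewrite /= in_f.
exists f; split=> // [i i_k | x i i_fx].
- have /set0Pn[x xi] : nth set0 P i != set0.
    by apply: contraNneq P_n0 => <-; rewrite inE mem_nth ?size_tuple.
  by exists x; apply: fE.
- have i_k := ltn_trans i_fx (f_lt x).
  move/(pairwiseP set0)/(_ i (f x)): P_dom.
  rewrite !inE !size_tuple => /(_ i_k (f_lt x) i_fx)/forall_inP/(_ x (in_f x)).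
  by case/exists_inP=> y yi yx; exists y; rewrite ?(fE y i).
Qed.

(** A positive maximum is attained; positivity excludes the starting value 0 of the maximum, which
    comes with no partition. *)
Lemma transitivity_level_function (G : sgraph) : 0 < transitivity G ->
  exists f : G -> nat, level_function (transitivity G) f.
Proof.
rewrite /transitivity; elim/big_rec: _ => // i n /existsP[P trP] IHn.
case: (leqP i n) => // _ _; exact: transitive_partition_level_function trP.
Qed.

(** If a clause of [tight_levels] fails, some edge or vertex can be deleted so that [f] remains a
    level function with equally many levels, and the transitivity does not drop. *)
Lemma ve_critical_tight_levels (G : sgraph) (f : G -> nat) :
  ve_critical G -> level_function (transitivity G) f -> tight_levels f.
Proof.
case=> crit_v crit_e [f_lt f_onto f_dom].
have not_del_edge x y : edge x y ->
    ~ (forall z i, i < f z -> exists2 w, @edge (del_edge x y) w z & f w = i).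
  move=> /crit_e; rewrite ltnNge => /negP ge dom; apply: ge.
  by apply: (@transitivity_ge _ (del_edge x y) f).
split=> [x y xy | x y z xz yz xz_lt fyx | x].
- apply/negP=> /eqP fxy; apply: (not_del_edge x y xy) => z i i_z.
  have [w wz fw] := f_dom z i i_z; exists w => //=.
  rewrite /del_edge_edge wz; apply/eqP=> E.
  have : w \in [set x; y] by rewrite -E set21.
  have : z \in [set x; y] by rewrite -E set22.
  by case/set2P=> Ez /set2P[] Ew; move: i_z; rewrite -fw Ez Ew ?fxy ltnn.
- apply/eqP/negPn/negP=> yx; apply: (not_del_edge x z xz) => t i i_t.
  have [w wt fw] := f_dom t i i_t.
  have [E|ne] := eqVneq [set w; t] [set x; z]; last by exists w; rewrite //= /del_edge_edge wt.
  (* A dominating edge goes from the lower level of [w] to the higher level of [t], so only one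
     orientation of the deleted edge is possible. Then [y] can replace [x] as the neighbour of
     [z]. *)
  have Et : t = z.
    have : w \in [set x; z] by rewrite -E set21.
    have : t \in [set x; z] by rewrite -E set22.
    case/set2P=> // Et /set2P[] Ew; move: i_t; rewrite -fw Et Ew ?ltnn //.
    by move/(ltn_trans xz_lt); rewrite ltnn.
  have Ew : w = x.
    have : w \in [set x; z] by rewrite -E set21.
    by case/set2P=> // Ew; move: i_t; rewrite -fw Et Ew ltnn.
  exists y; last by rewrite fyx -fw Ew.
  rewrite /= /del_edge_edge Et yz; apply: contra yx => /eqP E'.
  have : y \in [set x; z] by rewrite -E' set21.
  by case/set2P=> [-> // | Ey]; rewrite Ey edge_irrefl in yz.
- have [/exists_inP[y xy xy_lt]|none] := boolP [exists y in edge x, f x < f y].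
    by left; exists y.
  (* Deleting [x] keeps its level nonempty thanks to [y], and breaks no domination because [x] has
     no neighbour in a higher level. *)
  right=> y fyx; apply/eqP/negPn/negP=> yx.
  have := crit_v x; rewrite ltnNge => /negP; apply.
  apply: (@transitivity_ge _ (del_vertex x) (fun z => f (val z))).
  split=> [z | i /f_onto[z fz] | z i i_z]; first exact: f_lt.
  + have [Ez|zx] := eqVneq z x; last by exists (Sub z zx).
    by exists (Sub y yx); rewrite /= fyx -Ez.
  + have [w wz fw] := f_dom _ _ i_z.
    have wx : w != x.
      apply: contraNneq none => Ew; have fx : f x = i by rewrite -Ew.
      by rewrite Ew in wz; apply/exists_inP; exists (val z); rewrite // fx.
    by exists (Sub w wx).
Qed.

(* [L] is the level added last, that is V_1. *)
Lemma atoms_add_level t (G : sgraph) (L : pred G) :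
    (exists x, L x) ->
    (forall x y, L x -> L y -> ~~ edge x y) ->
    (forall x, L x -> exists2 y, ~~ L y & edge x y) ->
    (forall y, ~~ L y -> exists2 x, L x & edge x y) ->
    (forall x x' y, L x -> L x' -> ~~ L y -> edge x y -> edge x' y -> x' = x) ->
  atoms t (induced (predC L)) -> atoms t.+1 G.
Proof.
move=> [x0 Lx0] L_indep L_up L_dom L_uniq [H atomH /isomorphic_sym[psi [psi_bij psiE]]].
pose A := [set x | L x]; pose r := #|A|.
have LA (i : 'I_r) : L (enum_val i) by have := enum_valP i; rewrite inE.
have nL z : ~~ L (val (psi z)) := valP (psi z).
have [m mP] : exists m : 'I_r -> H, forall i, edge (enum_val i) (val (psi (m i))).
  apply: (@fin_all_exists _ (fun=> H)
    (fun (i : 'I_r) z => edge (enum_val i) (val (psi z)))) => i.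
  have [y nLy xy] := L_up _ (LA i); have [phi _ psiK] := psi_bij.
  by exists (phi (Sub y nLy)); rewrite psiK.
have [c cP] : exists c : H -> 'I_r, forall z, edge (enum_val (c z)) (val (psi z)).
  apply: (@fin_all_exists _ (fun=> 'I_r)
    (fun z (i : 'I_r) => edge (enum_val i) (val (psi z)))) => z.
  have [x Lx xz] := L_dom _ (nL z); have xA : x \in A by rewrite inE.
  by exists (enum_rank_in xA x); rewrite enum_rankK_in.
(* By uniqueness of the neighbour in [L], the map [c] determines all edges between [L] and the rest.
   In particular it recovers [i] from its partner [m i], so distinct vertices of [L] get distinct
   partners. *)
have cE i z : edge (enum_val i) (val (psi z)) = (c z == i).
  apply/idP/eqP=> [iz | <-] //; apply: enum_val_inj.
  exact: L_uniq iz (cP z).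
have mK : cancel m c by move=> i; apply/eqP; rewrite -cE.
have m_inj := can_inj mK.
pose W := [set m i | i : 'I_r].
exists (atom_ext W m c).
  apply: AtomS => //; last by rewrite card_imset ?card_ord.
  apply/andP; split; first by apply/card_gt0P; exists x0; rewrite inE.
  by have := leq_card _ m_inj; rewrite card_ord.
apply: isomorphic_sym.
pose g (a : atom_ext W m c) : G :=
  match a with inl z => val (psi z) | inr i => enum_val i end.
exists g; split.
- apply: inj_card_bij => [[z|i] [z'|i'] /= E | ].
  + by congr inl; apply: (bij_inj psi_bij); apply: val_inj.
  + by have := nL z; rewrite [val _]E LA.
  + by have := nL z'; rewrite -[val _]E LA.
  + by congr inr; apply: enum_val_inj.
  + rewrite card_sum card_ord (bij_eq_card psi_bij) card_sig.
    by rewrite -(cardC L) addnC leq_add2l /r /A cardsE.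
(* On [W] the matching agrees with [c], because [c (m j) = j]. *)
- have join z i : edge (val (psi z)) (enum_val i) = atom_join W m c z i.
    rewrite edge_sym cE /atom_join; case: ifP => // /imsetP[j _ ->].
    by rewrite mK (inj_eq m_inj) eq_sym.
  move=> [z|i] [z'|i'] /=; rewrite -?psiE ?join //.
  + by rewrite edge_sym join.
  + by apply/negbTE/L_indep.
Qed.

Lemma tight_levels_atoms k (G : sgraph) (f : G -> nat) :
  level_function k.+1 f -> tight_levels f -> atoms k.+1 G.
Proof.
elim: k G f => [|k IHk] G f [f_lt f_onto f_dom] [f_indep f_uniq f_up].
  have f0 x : f x = 0 by case: (f x) (f_lt x).
  have [x0 _] := f_onto 0 isT.
  (* With a single level no vertex has a neighbour in a higher one, so each is alone in its
     level. *)
  have all_x0 x : x = x0.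
    have [[y _]|uniq_x0] := f_up x0; first by rewrite !f0.
    by apply: uniq_x0; rewrite !f0.
  exists K1; first exact: Atom1.
  exists (fun=> tt); split; first by exists (fun=> x0) => [x | []].
  by move=> x y; rewrite (all_x0 x) (all_x0 y) !edge_irrefl.
apply: (@atoms_add_level _ _ (fun x => f x == 0)).
- by have [x fx] := f_onto 0 isT; exists x; rewrite fx.
- by move=> x y /eqP fx /eqP fy; apply/negP=> /f_indep; rewrite fx fy.
- move=> x /eqP fx; case: (f_up x) => [[y xy] | x_only].
    by rewrite fx lt0n => fy; exists y.
  (* A vertex alone in level 0 is the only one that can dominate the top level, which supplies its
     upper neighbour. *)
  have [y fy] := f_onto k.+1 (ltnSn _).
  have [|w wy fw] := f_dom y 0; first by rewrite fy.
  by exists y; [rewrite fy | rewrite -(x_only w) ?fx].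
- by move=> y; rewrite -lt0n => /f_dom[x xy fx]; exists x; rewrite ?fx.
- move=> x x' y /eqP fx /eqP fx'; rewrite -lt0n -{1}fx => lt xy x'y.
  by apply: f_uniq xy x'y lt _; rewrite fx fx'.
pose upper : pred G := predC (fun x => f x == 0).
have pos (x : induced upper) : 0 < f (val x).
  by rewrite lt0n; apply: (valP x).
(* The remaining levels move down by one; by [pos] the predecessor loses no information on them. *)
apply: (IHk (induced upper) (fun x => (f (val x)).-1)); split.
- by move=> x; rewrite -ltnS prednK.
- move=> i i_k; have [x fx] := f_onto i.+1 i_k.
  have fx0 : upper x by rewrite /upper /= fx.
  by exists (Sub x fx0); rewrite /upper /= fx.
- move=> x i i_x; have [|y yx fy] := f_dom (val x) i.+1; first by rewrite -ltn_predRL.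
  have fy0 : upper y by rewrite /upper /= fy.
  by exists (Sub y fy0); rewrite //= fy.
- move=> x y /f_indep; apply: contraNneq => E.
  by rewrite -(prednK (pos x)) -(prednK (pos y)) E.
- move=> x y z xz yz lt E; apply: val_inj; apply: (f_uniq _ _ _ xz yz).
    by rewrite -(prednK (pos x)) -(prednK (pos z)).
  by rewrite -(prednK (pos x)) -(prednK (pos y)) E.
- move=> x; have [[y xy lt]|x_only] := f_up (val x); [left | right].
    have fy_gt0 : 0 < f y by apply: leq_ltn_trans lt.
    have fy0 : upper y by rewrite /upper /= -lt0n.
    by exists (Sub y fy0); rewrite //= -ltnS (prednK fy_gt0) (prednK (pos x)).
  move=> y E; apply: val_inj; apply: x_only.
  by rewrite -(prednK (pos x)) -(prednK (pos y)) E.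
Qed.

Lemma Tr_ve_critical_atoms k (G : sgraph) :
  0 < k -> Tr_ve_critical k G -> atoms k G.
Proof.
move=> k_gt0 [crit TrG]; rewrite -TrG in k_gt0 *.
have [f f_level] := transitivity_level_function k_gt0.
move: f_level (ve_critical_tight_levels crit f_level).
by rewrite -(prednK k_gt0); apply: tight_levels_atoms.
Qed.

(** Not being a bad atom only refutes non-criticality; deciding criticality by finite checks removes
    the double negation constructively. *)
Lemma Tr_ve_critical_dec k (G : sgraph) :
  Tr_ve_critical k G \/ ~ Tr_ve_critical k G.
Proof.
pose b := [&& [forall v : G, transitivity (del_vertex v) < transitivity G],
  [forall u : G, forall v : G,
    edge u v ==> (transitivity (del_edge u v) < transitivity G)]
  & transitivity G == k].
have bP : reflect (Tr_ve_critical k G) b.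
  apply: (iffP and3P) => [[/forallP v_crit /forallP e_crit /eqP TrG] |
                          [[v_crit e_crit] TrG]].
    by split=> //; split=> // u v; apply/implyP/(forallP (e_crit u)).
  split; [exact/forallP | | exact/eqP].
  by apply/forallP=> u; apply/forallP=> v; apply/implyP/e_crit.
by case: bP; [left | right].
Qed.

Theorem theorem5 (k : nat) (hk : 1 <= k) (G : sgraph) :
  Tr_ve_critical k G <-> good_atoms k G.
Proof.
split=> [crit | [atomG not_bad]].
  split; first exact: Tr_ve_critical_atoms.
  by case=> _ [/(_ crit) | ne] //; case: crit.
case: (Tr_ve_critical_dec k G) => // ncrit.
by case: not_bad; split=> //; left.
Qed.
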